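(* Let $m,k\ge1$, $q=2^{km}$, $d=2^m$, and let $\mathrm{AG}(2,q)$ be $\mathrm{PG}(2,q)$ with the line $z=0$ deleted. Let $A_1,\dots,A_{\frac{q-1}{d-1}}$ be maximal arcs of degree $d$ in $\mathrm{PG}(2,q)$, contained in $\mathrm{AG}(2,q)$, such that there is a point $P$ with $A_i\cap A_j=\{P\}$ for all $i\ne j$ and $\bigcup_i A_i$ equal to the point set of $\mathrm{AG}(2,q)$. Assume there is a cyclic group $L$ of linear collineations of $\mathrm{PG}(2,q)$, of order $(d-1)(q+1)$, which stabilizes each $A_i$ and acts sharply transitively on $A_i\setminus\{P\}$ for each $i$. Then the arcs arise as in the following construction: in suitable homogeneous coordinates of $\mathrm{PG}(2,q)$ (with $z=0$ still the deleted line) one has $P=(0,0,1)$, there is $b\in\mathbb{F}_q$ with $x^2+bx+1$ irreducible over $\mathbb{F}_q$, and, writing $F_l$ for the point set $x^2+bxy+y^2+lz^2=0$, the arcs are $A_i=\bigcup_{l\in H_i}F_l$ where $H_i=c_i\mathbb{F}_d$, with $c_1\mathbb{F}_d^*,\dots,c_{\frac{q-1}{d-1}}\mathbb{F}_d^*$ the distinct multiplicative cosets of $\mathbb{F}_d^*$ in $\mathbb{F}_q^*$ (here $\mathbb{F}_d$ is the subfield of order $d$ of $\mathbb{F}_q$).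
   Context: A maximal arc of degree $d$ in a projective plane of order $q$ (with $d\mid q$) is a set $A$ of $(q-q/d+1)d$ points such that every line is either disjoint from $A$ or meets $A$ in exactly $d$ points. *)

(* Defs.v *)
From HB Require Import structures.
From mathcomp Require Import all_boot all_order all_algebra all_fingroup.
From mathcomp Require Import all_solvable.

Set Implicit Arguments.
Unset Strict Implicit.
Unset Printing Implicit Defensive.

Import GRing.Theory.
Local Open Scope ring_scope.

(* The subtype structure of {vspace vT} over a matrix type is only visible
   inside VectorInternalTheory. *)
Section FinVspace.
Import VectorInternalTheory.
Variables (F : finFieldType) (vT : vectType F).
HB.instance Definition _ := [Countable of {vspace vT} by <:].
HB.instance Definition _ := [Finite of {vspace vT} by <:].
End FinVspace.

(* PG(2, q): the points (lines) are the 1-dimensional (2-dimensional)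
   subspaces of F^3, and incidence is inclusion. *)
Section ProjectivePlane.
Variable F : finFieldType.

Record point := Point
  { point_space :> {vspace 'rV[F]_3}; _ : \dim point_space == 1%N }.
HB.instance Definition _ := [isSub for point_space].
HB.instance Definition _ := [Finite of point by <:].

Record line := Line
  { line_space :> {vspace 'rV[F]_3}; _ : \dim line_space == 2%N }.
HB.instance Definition _ := [isSub for line_space].
HB.instance Definition _ := [Finite of line by <:].

Definition line_points (l : line) : {set point} := [set p : point | (p <= l)%VS].

Definition maximal_arc (d : nat) (A : {set point}) : Prop :=
  [/\ (d %| #|F|)%N,
      #|A| = ((#|F| - #|F| %/ d + 1) * d)%N
    & forall l : line,
        [disjoint line_points l & A] \/ #|line_points l :&: A| = d].

Definition linear_collineation (g : {perm point}) : Prop :=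
  exists2 f : 'End('rV[F]_3), lker f == 0%VS
    & forall p : point, point_space (g p) = (f @: p)%VS.

(* A system of homogeneous coordinates is an invertible phi : F^3 -> F^3; the
   new coordinates of the point <[v]> are the entries of phi v.  [locus phi Q]
   is the set of points whose new coordinates satisfy Q = 0; it is only used
   for homogeneous Q, for which vanishing on one nonzero vector of a point or
   on all its vectors is the same. *)
Definition locus (phi : 'End('rV[F]_3)) (Q : F -> F -> F -> F) : {set point} :=
  [set p : point | [forall v : 'rV[F]_3, (v \in point_space p) ==>
     (Q (phi v ord0 0) (phi v ord0 1) (phi v ord0 2%:R) == 0)]].

Definition line_z0 (phi : 'End('rV[F]_3)) : {set point} :=
  locus phi (fun _ _ z => z).

(* AG(2, q): the line z = 0 of the original coordinates is deleted. *)
Definition affine_points : {set point} := ~: line_z0 \1%VF.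

(* Degenerate for l = 0. *)
Definition conic (phi : 'End('rV[F]_3)) (b l : F) : {set point} :=
  locus phi (fun x y z => x ^+ 2 + b * x * y + y ^+ 2 + l * z ^+ 2).

End ProjectivePlane.

Definition sharply_transitive (T : finType) (G : {group {perm T}})
    (S : {set T}) : Prop :=
  [acts G, on S | 'P] /\
  {in S &, forall x y, #|amove 'P G x y| = 1%N}.

(* For a finite field, the subfield of order d, if any, is unique. *)
Definition subfield_of_order (F : finFieldType) (d : nat) (K : {set F}) : Prop :=
  GRing.divring_closed K /\ #|K| = d.

(* The coset x K^* of the multiplicative group of the subfield K. *)
Definition mul_coset (F : finFieldType) (K : {set F}) (x : F) : {set F} :=
  [set x * u | u in K :\ 0].

(* Main.v *)
Require Import Defs.
From HB Require Import structures.
From mathcomp Require Import all_boot all_order all_algebra all_fingroup.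
From mathcomp Require Import all_solvable all_field ring zify.

(* Each element of L fixes P and the line at infinity, and L acts freely on the
   affine points other than P.  Normalise a generator to a linear map f fixing a
   vector w above P.  An eigenvector of f on the line at infinity would give an
   affine point other than P fixed by the (q-1)-st power of the generator,
   whose order (d-1)(q+1) exceeds q-1; so the binary form u |-> det(u, f u) is
   anisotropic, and f multiplies it by a = det f.  As q is even, det f is a
   square and coordinates exist in which this form is proportional to
   x^2+bxy+y^2.  Let N = (x^2+bxy+y^2)/z^2 on affine points.  Then
   a^((d-1)(q+1)) = 1 = a^(q-1) and gcd(q+1, q-1) = 1 give a^(d-1) = 1, i.e.
   a lies in K = F_d, so N maps each orbit A_i minus P into one coset of K^*.
   The arcs cover the plane and N is onto, so every coset is hit; there are as
   many arcs as cosets, hence A_i minus P is the full preimage of its coset. *)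

Set Implicit Arguments.
Unset Strict Implicit.
Unset Printing Implicit Defensive.

Import GRing.Theory.
Local Open Scope ring_scope.

(** * Coordinates on [F^3] and the normal form of a plane similarity *)

Section FiniteField.
Variable F : finFieldType.

Lemma ord3_cases (i : 'I_3) : [\/ i = 0, i = 1 | i = 2%:R].
Proof.
case: i => [[|[|[|//]]] Hi]; [constructor 1|constructor 2|constructor 3];
  exact: val_inj.
Qed.

Lemma rV3P (u v : 'rV[F]_3) :
  u 0 0 = v 0 0 -> u 0 1 = v 0 1 -> u 0 2%:R = v 0 2%:R -> u = v.
Proof.
by move=> e0 e1 e2; apply/rowP => i; case: (ord3_cases i) => ->.
Qed.

Definition row3 (x y z : F) : 'rV[F]_3 := \row_j [:: x; y; z]`_j.

Lemma row3E x y z :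
  (row3 x y z 0 0 = x) * (row3 x y z 0 1 = y) * (row3 x y z 0 2%:R = z).
Proof. by rewrite !mxE. Qed.

Lemma combE (a b c : F) (u v w : 'rV[F]_3) j :
  (a *: u + b *: v + c *: w) 0 j = a * u 0 j + b * v 0 j + c * w 0 j.
Proof. by rewrite !mxE. Qed.

Lemma linear_endo (h : 'rV[F]_3 -> 'rV[F]_3) :
  linear h -> exists phi : 'End('rV[F]_3), phi =1 h.
Proof.
move=> lh.
pose hM := GRing.isLinear.Build F 'rV[F]_3 'rV[F]_3 *:%R h lh.
pose hL : {linear 'rV[F]_3 -> 'rV[F]_3} := HB.pack h hM.
by exists (linfun hL) => v; rewrite lfunE.
Qed.

(** For a 2 x 2 matrix M, det(M u, M (M u)) = det M * det(u, M u), and det(u, M u) vanishes only at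
    0 and at eigenvectors. In the basis e, M e this form is, up to a constant, x^2 + (tr M) x y +
    (det M) y^2; dividing the second basis vector by a square root of det M makes both square
    coefficients 1. *)
Lemma similarity_normal_form (f : 'End('rV[F]_3)) (w : 'rV[F]_3) :
  (forall x : F, exists y, y ^+ 2 = x) -> f w = w -> w 0 2%:R = 1 ->
  (forall v : 'rV[F]_3, v 0 2%:R = 0 -> f v 0 2%:R = 0) ->
  (forall (v : 'rV[F]_3) l, v 0 2%:R = 0 -> f v = l *: v -> v = 0) ->
  exists (phi : 'End('rV[F]_3)) (b a : F),
    [/\ lker phi == 0%VS, phi w = delta_mx 0 2%:R,
        forall v, phi v 0 2%:R = v 0 2%:R,
        forall x y, x ^+ 2 + b * x * y + y ^+ 2 = 0 -> x = 0 /\ y = 0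
      & forall v, f v 0 2%:R = v 0 2%:R /\
        phi (f v) 0 0 ^+ 2 + b * phi (f v) 0 0 * phi (f v) 0 1
          + phi (f v) 0 1 ^+ 2
        = a * (phi v 0 0 ^+ 2 + b * phi v 0 0 * phi v 0 1 + phi v 0 1 ^+ 2)].
Proof.
move=> hsq fw w2 fW noev.
(* On u = v - z w, f acts by the matrix with columns (p, r) and (al, be). *)
pose p := f (row3 1 0 0) 0 0; pose r := f (row3 1 0 0) 0 1.
pose al := f (row3 0 1 0) 0 0; pose be := f (row3 0 1 0) 0 1.
have decomp (v : 'rV[F]_3) : v = (v 0 0 - v 0 2%:R * w 0 0) *: row3 1 0 0
   + (v 0 1 - v 0 2%:R * w 0 1) *: row3 0 1 0 + v 0 2%:R *: w.
  by apply: rV3P; rewrite combE !row3E ?w2; ring.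
have f2 (v : 'rV[F]_3) : f v 0 2%:R = v 0 2%:R.
  rewrite [in LHS](decomp v) !linearD !linearZ /= fw combE.
  by rewrite (fW (row3 1 0 0)) ?row3E // (fW (row3 0 1 0)) ?row3E // w2; ring.
have f0 (v : 'rV[F]_3) : f v 0 0 = (v 0 0 - v 0 2%:R * w 0 0) * p
   + (v 0 1 - v 0 2%:R * w 0 1) * al + v 0 2%:R * w 0 0.
  by rewrite [in LHS](decomp v) !linearD !linearZ /= fw combE.
have f1 (v : 'rV[F]_3) : f v 0 1 = (v 0 0 - v 0 2%:R * w 0 0) * r
   + (v 0 1 - v 0 2%:R * w 0 1) * be + v 0 2%:R * w 0 1.
  by rewrite [in LHS](decomp v) !linearD !linearZ /= fw combE.
(* If [r] were 0, [row3 1 0 0] would be an eigenvector with eigenvalue [p]. *)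
have r0 : r != 0.
  apply/eqP => r0.
  have: row3 1 0 0 = 0.
    apply: (noev _ p); rewrite ?row3E //.
    by apply: rV3P; rewrite [in RHS]mxE row3E ?f2 ?row3E ?mulr1 ?mulr0.
  by move/matrixP/(_ 0 0)/eqP; rewrite row3E mxE oner_eq0.
pose D := p * be - r * al.
have [s sE] := hsq D.
(* The form below is det(u, f u). *)
have noev' u0 u1 : r * u0 ^+ 2 + (be - p) * u0 * u1 - al * u1 ^+ 2 = 0 ->
    u0 = 0 /\ u1 = 0.
  move=> e.
  have fu : f (row3 u0 u1 0) = row3 (u0 * p + u1 * al) (u0 * r + u1 * be) 0.
    by apply: rV3P; rewrite ?f0 ?f1 ?f2 !row3E; ring.
  suff [l le] : exists l, f (row3 u0 u1 0) = l *: row3 u0 u1 0.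
    have u_eq0 : row3 u0 u1 0 = 0 by apply: (noev _ l); rewrite ?row3E.
    by split; [move/matrixP/(_ 0 0): u_eq0 | move/matrixP/(_ 0 1): u_eq0];
      rewrite row3E mxE.
  (* The vanishing determinant makes [f u] parallel to [u]; the eigenvalue is read off at a nonzero
     coordinate of [u]. *)
  rewrite fu; have [u00|u00] := eqVneq u0 0.
    have [u10|u10] := eqVneq u1 0.
      by exists 0; apply: rV3P; rewrite [in RHS]mxE !row3E ?u00 ?u10; ring.
    exists be; apply: rV3P; rewrite [in RHS]mxE !row3E ?u00; try ring.
    apply: (mulIf u10); move: e; rewrite u00 => e.
    by apply/eqP; rewrite -subr_eq0 -oppr_eq0; apply/eqP; rewrite -[RHS]e; ring.
  exists (p + u1 * al / u0); apply: rV3P; rewrite [in RHS]mxE !row3E; try by field.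
  apply: (mulIf u00); apply/eqP; rewrite -subr_eq0; apply/eqP.
  by rewrite -[RHS]e; field.
(* If [D = 0], then [(- be, r)] lies in the kernel of the matrix and so is a nontrivial zero of the
   form. *)
have s0 : s != 0.
  apply/eqP => s0; have D0 : D = 0 by rewrite -sE s0; ring.
  have [|_ /eqP] := noev' (- be) r; last by rewrite (negPf r0).
  by rewrite -[RHS](mul0r r) -D0 /D; ring.
(* X and Y are the coordinates of u in the basis e, f e / s with e = (1, 0). *)
pose b := (p + be) / s.
pose X (v : 'rV[F]_3) := (v 0 0 - v 0 2%:R * w 0 0) - (v 0 1 - v 0 2%:R * w 0 1) * p / r.
pose Y (v : 'rV[F]_3) := s * (v 0 1 - v 0 2%:R * w 0 1) / r.
have [|phi phiE] := @linear_endo (fun v => row3 (X v) (Y v) (v 0 2%:R)).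
  by move=> c u v; apply: rV3P; rewrite 3!mxE ?row3E /X /Y !mxE /=; ring.
(* The divisor [r] is det(e, f e), the value of the form at e. *)
have QE v : (X v) ^+ 2 + b * X v * Y v + (Y v) ^+ 2 =
  (r * (v 0 0 - v 0 2%:R * w 0 0) ^+ 2
   + (be - p) * (v 0 0 - v 0 2%:R * w 0 0) * (v 0 1 - v 0 2%:R * w 0 1)
   - al * (v 0 1 - v 0 2%:R * w 0 1) ^+ 2) / r.
  rewrite /Y exprMn exprMn sE /X /b /D; field.
  by rewrite r0 s0.
exists phi, b, D; split.
- apply/lker0P => u v; rewrite !phiE => e.
  have e2 : u 0 2%:R = v 0 2%:R.
    by move/matrixP/(_ 0 2%:R): e; rewrite !row3E.
  have e1 : u 0 1 = v 0 1.
    move/matrixP/(_ 0 1): e; rewrite !row3E /Y e2.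
    by move/(divIf r0)/(mulfI s0)/(addIr _).
  apply: rV3P => //.
  move/matrixP/(_ 0 0): e; rewrite !row3E /X e2 e1.
  by move/(addIr _)/(addIr _).
- by rewrite phiE; apply: rV3P; rewrite ?row3E !mxE /= /X /Y w2; ring.
- by move=> v; rewrite phiE row3E.
- move=> x y e.
  (* The vector at infinity whose new coordinates are [x] and [y]. *)
  have := QE (row3 (x + y * p / s) (y * r / s) 0).
  rewrite /X /Y !row3E !mul0r !subr0.
  have -> : x + y * p / s - y * r / s * p / r = x by field; rewrite r0 s0.
  have -> : s * (y * r / s) / r = y by field; rewrite r0 s0.
  rewrite e => /esym/eqP; rewrite mulf_eq0 invr_eq0 (negPf r0) orbF => /eqP.
  move=> /noev' [e1 e2].
  have y0 : y = 0.
    by move/eqP: e2; rewrite !mulf_eq0 invr_eq0 (negPf r0) (negPf s0) !orbF => /eqP.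
  by move: e1; rewrite y0 !mul0r addr0.
- move=> v; split=> //.
  rewrite !phiE !row3E !QE f2 f0 f1 /D; field.
  exact: r0.
Qed.

(** * Points, loci and collineations in terms of spanning vectors *)

Lemma point_vline (p : point F) :
  exists2 v, v != 0 & point_space p = <[v]>%VS.
Proof.
case: p => U /= dU; have U0 : vpick U != 0.
  by rewrite vpick0 -dimv_eq0 (eqP dU).
exists (vpick U) => //; apply/esym/eqP.
by rewrite eqEdim -memvE memv_pick dim_vline U0 (eqP dU).
Qed.

Lemma vline_point (v : 'rV[F]_3) :
  v != 0 -> exists p : point F, point_space p = <[v]>%VS.
Proof.
by move=> v0; have H : \dim <[v]> == 1%N; [rewrite dim_vline v0 | exists (Point H)].
Qed.

Lemma point_inj (p r : point F) : point_space p = point_space r -> p = r.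
Proof. exact: val_inj. Qed.

Lemma mem_locus (phi : 'End('rV[F]_3)) (Q : F -> F -> F -> F) (p : point F) v :
  (forall k x y z, Q x y z = 0 -> Q (k * x) (k * y) (k * z) = 0) ->
  point_space p = <[v]>%VS ->
  (p \in locus phi Q) = (Q (phi v 0 0) (phi v 0 1) (phi v 0 2%:R) == 0).
Proof.
move=> hQ pv; rewrite inE pv; apply/forallP/eqP => [/(_ v)|Qv u].
  by rewrite memv_line => /eqP.
apply/implyP => /vlineP[k ->]; rewrite linearZ !mxE; apply/eqP.
exact: hQ.
Qed.

Lemma mem_affine (p : point F) v : point_space p = <[v]>%VS ->
  (p \in affine_points F) = (v 0 2%:R != 0).
Proof.
move=> pv; rewrite in_setC (mem_locus _ _ pv) ?id_lfunE //.
by move=> k _ _ z ->; rewrite mulr0.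
Qed.

Lemma mem_conic phi b l (p : point F) v : point_space p = <[v]>%VS ->
  (p \in conic phi b l) = (phi v 0 0 ^+ 2 + b * phi v 0 0 * phi v 0 1
     + phi v 0 1 ^+ 2 + l * phi v 0 2%:R ^+ 2 == 0).
Proof.
move=> pv; rewrite (mem_locus _ _ pv) // => k x y z e.
by rewrite -[RHS](mulr0 (k ^+ 2)) -e; ring.
Qed.

Lemma perm_exp_line (g : {perm point F}) (f : 'End('rV[F]_3)) n (p : point F) v :
  (forall p : point F, point_space (g p) = (f @: p)%VS) ->
  point_space p = <[v]>%VS ->
  point_space ((g ^+ n)%g p) = <[iter n f v]>%VS.
Proof.
move=> gf pv; elim: n => [|n IH]; first by rewrite expg0 perm1.
by rewrite expgSr permM gf IH limg_line.
Qed.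

(** A linear map inducing [g] may be rescaled freely: dividing it by its eigenvalue at [P] makes the
    vectors above [P] fixed, and as [P] is affine one of them has last coordinate 1. *)
Lemma linear_collineation_lift (g : {perm point F}) (P : point F) :
  linear_collineation g -> P \in affine_points F -> g P = P ->
  exists (f : 'End('rV[F]_3)) (w : 'rV[F]_3),
    [/\ forall p : point F, point_space (g p) = (f @: p)%VS,
        point_space P = <[w]>%VS, w 0 2%:R = 1 & f w = w].
Proof.
move=> [f kf gf] Paff gP.
have [v v0 Pv] := point_vline P.
have v2 : v 0 2%:R != 0 by rewrite -(mem_affine Pv).
have := gf P; rewrite gP Pv limg_line => e.
have : f v \in <[v]>%VS by rewrite e memv_line.
case/vlineP => l fv; have l0 : l != 0.
  apply: contra_neq v0 => l0; apply: (lker0P kf).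
  by rewrite fv l0 scale0r linear0.
have lineZ k (u : 'rV[F]_3) : k != 0 -> <[k *: u]>%VS = <[u]>%VS.
  move=> k0; apply/eqP; rewrite eqEsubv -!memvE memvZ ?memv_line //=.
  by rewrite -[X in X \in _](scalerK k0) memvZ ?memv_line.
exists (l^-1 *: f), ((v 0 2%:R)^-1 *: v); split.
- move=> p; have [u u0 pu] := point_vline p.
  by rewrite gf pu !limg_line scale_lfunE lineZ ?invr_eq0.
- by rewrite lineZ ?invr_eq0.
- by rewrite mxE mulVf.
- rewrite scale_lfunE linearZ /= fv !scalerA; congr (_ *: _).
  by field; rewrite v2 l0.
Qed.

Lemma expf_card_pred (x : F) : x != 0 -> x ^+ (#|F| - 1) = 1.
Proof.
move=> x0; apply: (mulfI x0).
by rewrite mulr1 -exprS subn1 prednK ?expf_card //; apply/card_gt0P; exists 0.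
Qed.

(** [N] is the quotient of an anisotropic binary form by z^2. Both have degree 2, so [N] is a
    function of the affine point alone; its level sets are the conics of the pencil, and [g] scales
    it by a constant. *)
Lemma collineation_invariant_pencil (g : {perm point F}) (P : point F) :
  2 \in [pchar F] ->
  (forall x : F, exists y, y ^+ 2 = x) ->
  linear_collineation g -> P \in affine_points F -> g P = P ->
  (forall p, (g p \in affine_points F) = (p \in affine_points F)) ->
  (forall p, p \in affine_points F -> p != P ->
     (g ^+ (#|F| - 1))%g p != p) ->
  exists (phi : 'End('rV[F]_3)) (b a : F) (N : point F -> F),
    [/\ [/\ lker phi == 0%VS, line_z0 phi = line_z0 \1%VF
          & (phi @: P)%VS = <[delta_mx ord0 2%:R]>%VS],
        irreducible_poly ('X^2 + b *: 'X + 1),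
        forall p l, (p \in conic phi b l) = (p \in affine_points F) && (N p == l),
        forall x, exists2 p, p \in affine_points F & N p = x
      & forall p, p \in affine_points F ->
          (N p == 0) = (p == P) /\ N (g p) = a * N p].
Proof.
move=> ch2 hsq glin Paff gP gaff gfree.
have [f [w [gf Pw w2 fw]]] := linear_collineation_lift glin Paff gP.
have fW (v : 'rV[F]_3) : v 0 2%:R = 0 -> f v 0 2%:R = 0.
  have [->|v0] := eqVneq v 0; first by rewrite linear0.
  have [p pv] := vline_point v0.
  move=> v2; apply/eqP; rewrite -[_ == _]negbK.
  have gpv : point_space (g p) = <[f v]>%VS by rewrite gf pv limg_line.
  by rewrite -(mem_affine gpv) gaff (mem_affine pv) v2 eqxx.
(* For an eigenvector [v] at infinity, the point above [w + v] is moved by the n-th power of [g] to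
   the one above [w + l ^+ n *: v]. At n = q - 1 it returns to its place, against [gfree]. *)
have noev (v : 'rV[F]_3) l : v 0 2%:R = 0 -> f v = l *: v -> v = 0.
  move=> v2 fv; apply/eqP; apply: contraT => v0.
  have wv0 : w + v != 0.
    apply/eqP => /matrixP/(_ 0 2%:R)/eqP.
    by rewrite mxE w2 v2 addr0 mxE oner_eq0.
  have [p pv] := vline_point wv0.
  have paff : p \in affine_points F.
    by rewrite (mem_affine pv) mxE w2 v2 addr0 oner_eq0.
  have pP : p != P.
    apply: contra_neq v0 => pP; have: w + v \in <[w]>%VS.
      by rewrite -Pw -pP pv memv_line.
    case/vlineP => k e; have k1 : k = 1.
      by move/matrixP/(_ 0 2%:R): e; rewrite !mxE w2 v2 addr0 mulr1 => ->.
    by apply: (addrI w); rewrite addr0 e k1 scale1r.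
  (* Eigenvalue 0 would send the point spanned by [v] to the zero space. *)
  have l0 : l != 0.
    apply: contraL paff => /eqP l0.
    have [q qv] := vline_point v0.
    have /esym/eqP := congr1 (fun U : {vspace _} => \dim U) (gf q).
    case: (g q) => U /= /eqP ->.
    by rewrite qv limg_line fv l0 scale0r dim_vline eqxx.
  have itf n : iter n f (w + v) = w + l ^+ n *: v.
    elim: n => [|n IH]; first by rewrite scale1r.
    by rewrite iterS IH linearD linearZ /= fw fv scalerA exprSr.
  have := gfree p paff pP; rewrite -[_ != _]/(~~ (_ == _)); case/eqP.
  apply: point_inj; rewrite (perm_exp_line _ gf pv) itf pv.
  by rewrite expf_card_pred // scale1r.
have [phi [b [a [kphi phiw phi2 aniso invQ]]]] :=
  similarity_normal_form hsq fw w2 fW noev.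
pose Q (v : 'rV[F]_3) := phi v 0 0 ^+ 2 + b * phi v 0 0 * phi v 0 1 + phi v 0 1 ^+ 2.
have QZ k v : Q (k *: v) = k ^+ 2 * Q v by rewrite /Q linearZ !mxE; ring.
(* [vpick p] is an arbitrary spanning vector; [NE] shows that the choice does not matter. *)
pose N (p : point F) := Q (vpick p) / (vpick p 0 2%:R) ^+ 2.
have NE (p : point F) v : point_space p = <[v]>%VS -> v 0 2%:R != 0 ->
    N p = Q v / (v 0 2%:R) ^+ 2.
  move=> pv v2; have [k ke] : exists k, vpick p = k *: v.
    by apply/vlineP; rewrite -pv memv_pick.
  have k0 : k != 0.
    apply/eqP => k0; have /eqP := ke; rewrite k0 scale0r vpick0 pv.
    rewrite -dimv_eq0 dim_vline eqb0 negbK => /eqP v0.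
    by move: v2; rewrite v0 mxE eqxx.
  by rewrite /N ke QZ mxE; field; rewrite v2 k0.
exists phi, b, a, N; split.
- split=> //; last by rewrite Pw limg_line phiw.
  apply/setP => p; have [v v0 pv] := point_vline p.
  by rewrite !(mem_locus _ _ pv) ?phi2 ?id_lfunE // => k _ _ z ->; rewrite mulr0.
- have sz : size ('X^2 + b *: 'X + 1 : {poly F}) = 3.
    rewrite -addrA size_polyDl ?size_polyXn // (leq_ltn_trans (size_polyD _ _)) //.
    rewrite gtn_max size_poly1 andbT (leq_ltn_trans (size_scale_leq _ _)) //.
    by rewrite size_polyX.
  (* In degree 2 it suffices to exclude roots, and a root [x] would give the zero [(x, 1)] of the
     anisotropic form. *)
  apply: cubic_irreducible => [|x]; first by rewrite sz.
  apply/rootP; rewrite !hornerE => e.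
  have [|_ /eqP] := aniso x 1; last by rewrite oner_eq0.
  by rewrite -[RHS]e; ring.
- move=> p l; have [v v0 pv] := point_vline p.
  rewrite (mem_conic _ _ _ pv) (mem_affine pv) -/(Q v) phi2.
  (* At infinity the conic equation reduces to the anisotropic form, so no conic has a point
     there. *)
  have [v2|v2] := eqVneq (v 0 2%:R) 0.
    rewrite v2 expr0n mulr0 addr0; apply/eqP => Qv.
    have [e0 e1] := aniso _ _ Qv; case/eqP: v0.
    apply: (lker0P kphi); rewrite linear0.
    by apply: rV3P; rewrite ?e0 ?e1 ?phi2 ?v2 mxE.
  (* Characteristic 2 absorbs the sign: the conic with parameter [l] is the level set [N = l] rather
     than [N = - l]. *)
  rewrite (NE _ _ pv v2) /= -(oppr_pchar2 ch2 (l * _)) subr_eq0.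
  by rewrite -[l in RHS]divr1 eqr_div ?oner_eq0 ?expf_neq0 // mulr1.
(* The point with new coordinates [(y, 0, 1)], where [y ^+ 2 = x], has [N = x]. *)
- move=> x; have [y ye] := hsq x.
  have [v phiv] : exists v, phi v = row3 y 0 1.
    have /lker0_lfunVK/(_ (row3 y 0 1)) := kphi; by exists (phi^-1%VF (row3 y 0 1)).
  have v2 : v 0 2%:R = 1 by rewrite -phi2 phiv row3E.
  have v0 : v != 0.
    by apply/eqP => v0; move/eqP: v2; rewrite v0 mxE eq_sym oner_eq0.
  have [p pv] := vline_point v0.
  exists p; first by rewrite (mem_affine pv) v2 oner_eq0.
  rewrite (NE _ _ pv) v2 ?oner_eq0 // /Q phiv !row3E -ye.
  by field; rewrite oner_eq0.
- move=> p paff; have [v v0 pv] := point_vline p.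
  have v2 : v 0 2%:R != 0 by rewrite -(mem_affine pv).
  have gpv : point_space (g p) = <[f v]>%VS by rewrite gf pv limg_line.
  have [fv2 Qf] := invQ v.
  split; last by rewrite (NE _ _ pv) // (NE _ _ gpv) ?fv2 // /Q Qf mulrA.
  rewrite (NE _ _ pv) // mulf_eq0 invr_eq0 expf_eq0 (negPf v2) orbF.
  apply/eqP/eqP => [/aniso[e0 e1]|pP].
    have vw : v = v 0 2%:R *: w.
      apply: (lker0P kphi); rewrite linearZ /= phiw.
      by apply: rV3P; rewrite ?e0 ?e1 ?phi2 !mxE /= ?mulr0 ?mulr1.
    apply: point_inj; rewrite pv Pw; apply/eqP.
    rewrite eqEdim -memvE !dim_vline v0 [X in _ && X]leq_b1 andbT.
    by apply/vlineP; exists (v 0 2%:R).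
  have : v \in <[w]>%VS by rewrite -Pw -pP pv memv_line.
  by case/vlineP => k ->; rewrite QZ /Q phiw !mxE /=; ring.
Qed.
End FiniteField.


(** * Multiplicative cosets of a subfield *)

Lemma mul_coset_eq (F : finFieldType) (K : {set F}) (x y : F) :
  GRing.divring_closed K -> y \in mul_coset K x -> mul_coset K y = mul_coset K x.
Proof.
move=> [K1 KB KV].
have KM u v : u \in K -> v \in K -> u * v \in K.
  by move=> uK vK; rewrite -[v]invrK KV // -[v^-1]div1r KV.
case/imsetP => u; rewrite !inE => /andP[u0 uK] ->.
apply/setP => z; apply/imsetP/imsetP => -[t]; rewrite !inE => /andP[t0 tK] ->.
  by exists (u * t); rewrite ?mulrA // !inE mulf_neq0 ?KM.
exists (t / u); first by rewrite !inE mulf_neq0 ?invr_eq0 ?KV.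
by field.
Qed.

(* The bounds on #|K| and on the number of cosets force each other to be sharp:
   their product is #|F^*|. *)
Lemma covering_cosets (F : finFieldType) (K : {set F}) (n d : nat)
    (c : 'I_n -> F) :
  GRing.divring_closed K -> (#|K| <= d)%N -> (1 < d)%N -> (0 < n)%N ->
  (n * (d - 1) = #|F| - 1)%N ->
  (forall i, c i != 0) ->
  (forall x, x != 0 -> exists i, x \in mul_coset K (c i)) ->
  [/\ #|K| = d, injective (fun i => mul_coset K (c i))
    & [set mul_coset K (c i) | i in 'I_n] = [set mul_coset K x | x in [set~ 0]]].
Proof.
move=> hK Kd d1 n0 nd c0 cov; have [K1 KB KV] := hK.
have K0 : 0 \in K by rewrite -(subrr 1) KB.
have imE : [set mul_coset K (c i) | i in 'I_n] = [set mul_coset K x | x in [set~ 0]].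
  apply/setP => S; apply/imsetP/imsetP => -[x xin ->].
    by exists (c x); rewrite // !inE.
  rewrite !inE in xin; have [i xi] := cov x xin.
  by exists i; rewrite // (mul_coset_eq hK xi).
pose C := [set mul_coset K (c i) | i in 'I_n].
have Ccard : {in C, forall S : {set F}, #|S| = (#|K| - 1)%N}.
  move=> S /imsetP[i _ ->]; rewrite card_imset; last exact: mulfI.
  by rewrite (cardsD1 0 K) K0 addKn.
have Cpart : partition C [set~ 0].
  apply/and3P; split.
  - apply/eqP/setP => x; rewrite !inE; apply/bigcupP/idP.
      case=> S /imsetP[i _ ->] /imsetP[u]; rewrite !inE => /andP[u0 _] ->.
      by rewrite mulf_neq0.
    by move=> /cov[i xi]; exists (mul_coset K (c i)) => //; apply/imsetP; exists i.
  - apply/trivIsetP => S T /imsetP[i _ ->] /imsetP[j _ ->].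
    apply: contraR => /pred0Pn[x /andP[/= xi xj]].
    by rewrite -(mul_coset_eq hK xi) (mul_coset_eq hK xj) eqxx.
  - apply/imsetP => -[i _ /esym/setP/(_ (c i))].
    rewrite inE => /negP; apply; apply/imsetP; exists 1; rewrite ?mulr1 //.
    by rewrite !inE oner_eq0 K1.
have := card_uniform_partition Ccard Cpart.
rewrite cardsC1 -subn1 -nd => card_eq.
have Cn : (#|C| <= n)%N by rewrite -[n in (_ <= n)%N]card_ord leq_imset_card.
(* Here n (d - 1) = #|C| (#|K| - 1) <= #|C| (d - 1). *)
have CnE : #|C| = n.
  apply/eqP; rewrite eqn_leq Cn /= -(@leq_pmul2r (d - 1)) ?subn_gt0 //.
  by rewrite card_eq leq_mul2l leq_sub2r ?orbT.
split=> //.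
  move: card_eq; rewrite CnE => /eqP; rewrite eqn_pmul2l // => /eqP e.
  by rewrite -(subnK (ltnW d1)) e subnK // (cardD1 0) K0.
have /imset_injP inj : #|C| == #|'I_n| by rewrite CnE card_ord.
by move=> i j e; apply: inj.
Qed.

(** Closure holds because Frobenius is additive and multiplicative; the bound counts roots of
    X^(p^m) - X. An upper bound is enough, since [covering_cosets] turns it into an equality. *)
Lemma frobenius_fixed_field (F : finFieldType) (p m : nat) :
  p \in [pchar F] -> (0 < m)%N ->
  GRing.divring_closed [set x : F | x ^+ (p ^ m) == x] /\
  (#|[set x : F | x ^+ (p ^ m) == x]| <= p ^ m)%N.
Proof.
move=> chp m0; have pp := pcharf_prime chp.
have pm1 : (1 < p ^ m)%N by rewrite -(exp1n m) ltn_exp2r ?prime_gt1.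
have pnat_pm : [pchar F].-nat (p ^ m)%N.
  by rewrite pnatX (eq_pnat _ (pcharf_eq chp)) pnat_id.
split.
  split=> [|x y|x y]; rewrite !inE ?expr1n // => /eqP ex /eqP ey.
    by rewrite exprDn_pchar // exprNn_pchar // ex ey.
  by rewrite expr_div_n ex ey.
pose P : {poly F} := 'X^(p ^ m) - 'X.
have sP : size P = (p ^ m).+1.
  by rewrite size_polyDl ?size_polyXn // size_polyN size_polyX.
have P0 : P != 0 by rewrite -size_poly_eq0 sP.
rewrite cardE -ltnS -sP; apply: max_poly_roots => //; last exact: enum_uniq.
apply/allP => x; rewrite mem_enum inE => /eqP ex.
by rewrite rootE !hornerE ex subrr.
Qed.

(** * Regular permutation actions *)

Lemma sharply_transitive_free (T : finType) (G : {group {perm T}})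
    (S : {set T}) x g :
  sharply_transitive G S -> x \in S -> g \in G -> g x = x -> g = 1%g.
Proof.
move=> [_ st] xS gG gx; have /eqP/cards1P[h hE] := st x x xS xS.
have : g \in amove 'P G x x by rewrite inE gG /= apermE gx.
have : 1%g \in amove 'P G x x by rewrite inE group1 /= apermE perm1.
by rewrite hE !inE => /eqP -> /eqP.
Qed.

Lemma sharply_transitive_move (T : finType) (G : {group {perm T}})
    (S : {set T}) x y :
  sharply_transitive G S -> x \in S -> y \in S -> exists2 g, g \in G & g x = y.
Proof.
move=> [_ st] xS yS; have /eqP/cards1P[h hE] := st x y xS yS.
have : h \in amove 'P G x y by rewrite hE set11.
by rewrite inE /= apermE => /andP[hG /eqP hx]; exists h.
Qed.

Lemma sharply_transitive_card (T : finType) (G : {group {perm T}})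
    (S : {set T}) x :
  sharply_transitive G S -> x \in S -> #|S| = #|G|.
Proof.
move=> st xS; have -> : S = [set (g : {perm T}) x | g in G].
  apply/setP => y; apply/idP/imsetP => [yS|[g gG ->]].
    by have [g gG <-] := sharply_transitive_move st xS yS; exists g.
  by have [/actsP/(_ g gG x)] := st; rewrite /= apermE xS.
apply: card_in_imset => g h gG hG e.
apply/eqP; rewrite eq_mulgV1; apply/eqP.
apply: (sharply_transitive_free st xS); first by rewrite groupM ?groupV.
by rewrite permM e permK.
Qed.

(** * From the cyclic group to the pencil of conics *)

Theorem theorem2 (m k q d : nat) (hm : (1 <= m)%N) (hk : (1 <= k)%N)
    (hq : q = (2 ^ (k * m))%N) (hd : d = (2 ^ m)%N)
    (F : finFieldType) (hF : #|F| = q)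
    (A : 'I_((q - 1) %/ (d - 1)) -> {set point F})
    (hA : forall i, maximal_arc d (A i))
    (hAG : forall i, A i \subset affine_points F)
    (P : point F)
    (hP : forall i j, i != j -> A i :&: A j = [set P])
    (hcover : \bigcup_i A i = affine_points F)
    (L : {group {perm point F}})
    (hLcyc : cyclic L)
    (hLlin : forall g, g \in L -> linear_collineation g)
    (hLord : #|L| = ((d - 1) * (q + 1))%N)
    (hLstab : forall i, [acts L, on A i | 'P])
    (hLsharp : forall i, sharply_transitive L (A i :\ P)) :
  exists (phi : 'End('rV[F]_3)) (b : F) (K : {set F})
         (c : 'I_((q - 1) %/ (d - 1)) -> F),
    [/\ [/\ lker phi == 0%VS,
            line_z0 phi = line_z0 \1%VF
          & (phi @: P)%VS = <[delta_mx ord0 2%:R]>%VS],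
        irreducible_poly ('X^2 + b *: 'X + 1),
        subfield_of_order d K,
        injective (fun i => mul_coset K (c i)) /\
        [set mul_coset K (c i) | i in 'I_((q - 1) %/ (d - 1))]
          = [set mul_coset K x | x in [set~ 0]]
      & forall i, A i = \bigcup_(l in [set c i * u | u in K]) conic phi b l].
Proof.
have d2 : (1 < d)%N by rewrite hd -[X in (X < _)%N](exp1n m) ltn_exp2r.
have km0 : (0 < k * m)%N by rewrite muln_gt0 hk hm.
have q2 : (1 < q)%N by rewrite hq -[X in (X < _)%N](exp1n (k * m)) ltn_exp2r.
have dq : (d %| q)%N by rewrite hd hq dvdn_exp2l // leq_pmull.
have dleq : (d <= q)%N by rewrite dvdn_leq // ltnW.
have nd : (((q - 1) %/ (d - 1)) * (d - 1) = q - 1)%N.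
  by rewrite divnK // !subn1 hq hd mulnC expnM dvdn_pred_predX.
have n0 : (0 < (q - 1) %/ (d - 1))%N.
  by rewrite divn_gt0 ?leq_sub2r // subn_gt0.
have ch2 : 2 \in [pchar F] by apply: (card_finPcharP (n := (k * m)%N)); rewrite // hF.
(* The exponent is q / 2, so the square of the witness is [x ^+ q = x]. *)
have hsq (x : F) : exists y, y ^+ 2 = x.
  by exists (x ^+ (2 ^ (k * m).-1)); rewrite -exprM -expnSr prednK // -hq -hF expf_card.
have cardA i : #|A i| = (#|L| + 1)%N.
  have [_ -> _] := hA i; rewrite hF hLord.
  have : (q %/ d * d = q)%N by rewrite divnK.
  have : (q %/ d <= q)%N by rewrite leq_div.
  by nia.
(* Otherwise [A i] itself would be a regular orbit of size [#|L|], one less than [cardA] gives. This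
   count also settles the case of a single arc. *)
have PA i : P \in A i.
  apply: contraT => PnA.
  have AE : A i :\ P = A i.
    apply/setP => x; rewrite !inE andbC; case: (boolP (x \in A i)) => //= xA.
    by apply: contraNneq PnA => <-.
  have /card_gt0P[x xA] : (0 < #|A i|)%N by rewrite cardA addn1.
  have := sharply_transitive_card (hLsharp i) (x := x).
  by rewrite AE => /(_ xA); rewrite cardA => /eqP; rewrite -[X in _ == X]addn0 eqn_add2l.
have cardAP i : #|A i :\ P| = #|L|.
  by have := cardsD1 P (A i); rewrite PA cardA addnC => /addnI.
(* [L] stabilizes both an arc and that arc without [P]. *)
have gP g : g \in L -> g P = P.
  move=> gL; apply/eqP; apply: contraT => gPP.
  pose i0 := Ordinal n0.
  have gPA : g P \in A i0 by have /actsP/(_ g gL P) := hLstab i0; rewrite /= apermE PA.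
  have [/actsP/(_ g gL P)] := hLsharp i0.
  by rewrite /= apermE !inE eqxx gPP gPA.
have memA p : p \in affine_points F -> exists i, p \in A i.
  by rewrite -hcover => /bigcupP[i _ pA]; exists i.
have gaff g p : g \in L -> (g p \in affine_points F) = (p \in affine_points F).
  move=> gL; have gA i : (g p \in A i) = (p \in A i).
    by have /actsP/(_ g gL p) := hLstab i; rewrite /= apermE.
  rewrite -hcover; apply/bigcupP/bigcupP => -[i _ pA]; exists i => //.
    by rewrite -gA.
  by rewrite gA.
have gfree g p : g \in L -> p \in affine_points F -> p != P -> g p = p -> g = 1%g.
  move=> gL /memA[i pA] pP; apply: (sharply_transitive_free (hLsharp i)) => //.
  by rewrite !inE pP.
have /cyclicP[g Lg] := hLcyc.
have gL : g \in L by rewrite Lg cycle_id.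
have gord : #[g]%g = ((d - 1) * (q + 1))%N by rewrite -hLord Lg.
have Paff : P \in affine_points F by apply: (subsetP (hAG (Ordinal n0))).
have [|phi [b [a [N [hphi hb conicE Nsurj NP]]]]] :=
  collineation_invariant_pencil ch2 hsq (hLlin g gL) Paff (gP g gL)
   (fun p => gaff g p gL).
  move=> p paff pP; apply/eqP => e.
  have g1 : (g ^+ (#|F| - 1) = 1)%g by apply: (gfree _ p); rewrite ?groupX.
  have : (#[g]%g %| #|F| - 1)%N by rewrite order_dvdn g1.
  rewrite gord hF => /dvdn_leq; rewrite subn_gt0 => /(_ q2).
  by nia.
pose K := [set x : F | x ^+ d == x].
have [hK Kd] : GRing.divring_closed K /\ (#|K| <= d)%N.
  by rewrite /K hd; apply: frobenius_fixed_field.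
have Ng j p : p \in affine_points F -> N ((g ^+ j)%g p) = a ^+ j * N p.
  move=> paff; elim: j => [|j IH]; first by rewrite expg0 perm1 mul1r.
  have [_] := NP ((g ^+ j)%g p) (etrans (gaff _ _ (groupX j gL)) paff).
  by rewrite expgSr permM IH exprS mulrA => ->.
have /fin_all_exists[r rA] i : exists x, x \in A i :\ P.
  by apply/card_gt0P; rewrite cardAP.
have affAP i p : p \in A i :\ P -> p \in affine_points F /\ N p != 0.
  rewrite in_setD1 => /andP[pP pA]; have paff := subsetP (hAG i) p pA.
  by have [-> _] := NP p paff.
pose c i := N (r i).
have c0 i : c i != 0 by have [] := affAP i _ (rA i).
have aK : a \in K.
  pose i0 := Ordinal n0; have [raff _] := affAP _ _ (rA i0).
  (* Going once through the whole cycle of [g] returns [r i0] to itself, where [N] is nonzero. *)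
  have aord : a ^+ ((d - 1) * (q + 1)) = 1.
    apply: (mulIf (c0 i0)); rewrite -Ng // -gord expg_order perm1 mul1r //.
  have a0 : a != 0.
    apply/eqP => a0; move/eqP: aord.
    rewrite a0 expr0n muln_eq0 addn1 orbF subn_eq0 leqNgt d2 /= eq_sym.
    by rewrite oner_eq0.
  have aq := expf_card_pred a0; rewrite hF in aq.
  (* For [t = a ^+ (d - 1)], both [t ^+ (q + 1)] and [t ^+ (q - 1)] are 1, which leaves
     [t ^+ 2 = 1]; in characteristic 2 this says [(t - 1) ^+ 2 = 0]. *)
  have a2 : (a ^+ (d - 1)) ^+ 2 = 1.
    have e : (a ^+ (d - 1)) ^+ (q - 1) = 1 by rewrite exprAC aq expr1n.
    rewrite -[RHS]aord -[LHS]mulr1 -[X in _ * X]e -exprD -exprM; congr (a ^+ (_ * _)%N).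
    by lia.
  have : (a ^+ (d - 1) - 1) ^+ 2 = 0.
    rewrite sqrrB1 a2 -mulr_natr (pcharf0 ch2) mulr0 subr0.
    exact: addrr_pchar2.
  move/eqP; rewrite expf_eq0 /= subr_eq0 => /eqP ad.
  by rewrite inE -(subnK (ltnW d2)) exprD ad mul1r expr1.
have Ncoset i p : p \in A i :\ P -> N p \in mul_coset K (c i).
  move=> pA; have [raff _] := affAP _ _ (rA i).
  have [h] := sharply_transitive_move (hLsharp i) (rA i) pA.
  rewrite Lg => /cycleP[j ->] hp.
  have Npj : N p = a ^+ j * c i by rewrite -hp Ng.
  apply/imsetP; exists (a ^+ j); last by rewrite Npj mulrC.
  rewrite !inE -exprAC; have := aK; rewrite inE => /eqP ->; rewrite eqxx andbT.
  have [_] := affAP _ _ pA; rewrite Npj mulf_eq0 negb_or => /andP[] //.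
have cov x : x != 0 -> exists i, x \in mul_coset K (c i).
  have [p paff <-] := Nsurj x; have [-> _] := NP p paff => pP.
  by have [i pA] := memA p paff; exists i; apply: Ncoset; rewrite !inE pP.
have [cardK cinj cim] := covering_cosets hK Kd d2 n0 (etrans nd (congr1 (subn^~ 1%N) (esym hF))) c0 cov.
exists phi, b, K, c; split=> // i.
apply/setP => p; apply/idP/bigcupP => [pA|[l /imsetP[u uK ->]]].
  have paff := subsetP (hAG i) p pA.
  exists (N p); last by rewrite conicE paff /=.
  have [pP|pP] := eqVneq p P.
    (* [P] lies on the degenerate conic [l = 0], which is in the union because [0 \in K]. *)
    apply/imsetP; exists 0; first by rewrite inE expr0n -leqn0 leqNgt ltnW.
    by rewrite mulr0; apply/eqP; have [-> _] := NP p paff; apply/eqP.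
  have /Ncoset/imsetP[u] : p \in A i :\ P by rewrite !inE pP.
  by rewrite in_setD1 => /andP[_ uK] ->; apply: imset_f.
rewrite conicE => /andP[paff /eqP Np].
have [pP|pP] := eqVneq p P; first by rewrite pP.
(* The point lies in some arc [A j]; then [N p] is in the cosets of both [c i] and [c j], and
   injectivity forces [i = j]. *)
have [j pA] := memA p paff.
have pj : N p \in mul_coset K (c j) by apply: Ncoset; rewrite !inE pP.
have pi : N p \in mul_coset K (c i).
  rewrite Np; apply: imset_f; rewrite in_setD1 uK andbT.
  apply: contraNneq pP => u0; have [<- _] := NP p paff.
  by rewrite Np u0 mulr0.
by rewrite (cinj i j) //= -(mul_coset_eq hK pi) (mul_coset_eq hK pj).
Qed.
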